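(* Let $R$ be a ring, and let $M$ be an $R$-module. Then the following hold: (1) If $R$ is zero-dimensional, then $M$ is a cl.Hilbert module. (2) If $R$ is a one-dimensional domain and $M$ is torsion, then $M$ is a cl.Hilbert module. (3) If $M$ is Artinian, then $M$ is a cl.Hilbert module.
   Context: All rings are commutative with identity $1\neq 0$ and all modules are unital. A proper submodule $P$ of an $R$-module $M$ is classical prime if for all $a,b\in R$ and $m\in M$, $abm\in P$ implies $am\in P$ or $bm\in P$. An $R$-module $M$ is a cl.Hilbert module (classical Hilbert module) if every classical prime submodule of $M$ is an intersection of maximal submodules of $M$. Dimension means Krull dimension. *)

(* Defs.v *)
From mathcomp Require Export all_boot all_algebra.
From mathcomp Require Export boolp classical_sets.

Set Implicit Arguments.
Unset Strict Implicit.
Unset Printing Implicit Defensive.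

Import GRing.Theory.

Local Open Scope classical_set_scope.
Local Open Scope ring_scope.

(* Ideals and submodules are arbitrary subsets of the carrier; [in A] views
   such a subset as a predicate for the library's closure conditions. *)

Section Ring.
Variable R : comNzRingType.

(* [idealr_closed] includes properness (1 does not belong to the ideal). *)
Definition prime_ideal (I : set R) : Prop :=
  idealr_closed [in I] /\ prime_idealr_closed [in I].

Definition prime_chain (n : nat) (p : nat -> set R) : Prop :=
  (forall i, (i <= n)%N -> prime_ideal (p i)) /\
  (forall i, (i < n)%N -> p i `<` p i.+1).

(* n is the largest length of a strict chain p 0 < ... < p n of primes;
   no n satisfies this when the dimension is infinite. *)
Definition has_krull_dim (n : nat) : Prop :=
  (exists p, prime_chain n p) /\
  (forall m p, prime_chain m p -> (m <= n)%N).

End Ring.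

Section Module.
Variables (R : comNzRingType) (M : lmodType R).

Definition submodule (N : set M) : Prop := GRing.submod_closed [in N].

Definition proper_submodule (N : set M) : Prop := submodule N /\ N `<` setT.

Definition maximal_submodule (N : set M) : Prop :=
  proper_submodule N /\
  (forall K : set M, proper_submodule K -> N `<=` K -> K = N).

Definition classical_prime (P : set M) : Prop :=
  proper_submodule P /\
  (forall (a b : R) (m : M),
     P ((a * b) *: m) -> P (a *: m) \/ P (b *: m)).

Definition cl_Hilbert : Prop :=
  forall P : set M, classical_prime P ->
    exists F : set (set M),
      (forall N, F N -> maximal_submodule N) /\ P = \bigcap_(N in F) N.

(* Intended for R a domain: over a general ring, r would have to be regular. *)
Definition torsion_module : Prop :=
  forall m : M, exists2 r : R, r != 0 & r *: m = 0.

Definition artinian_module : Prop :=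
  forall N : nat -> set M,
    (forall i, submodule (N i)) -> (forall i, N i.+1 `<=` N i) ->
    exists k, forall i, (k <= i)%N -> N i = N k.

End Module.

Arguments has_krull_dim : clear implicits.
Arguments cl_Hilbert {R} M.
Arguments torsion_module {R} M.
Arguments artinian_module {R} M.

(* Main.v *)
(* If P is a classical prime submodule and x is not in P, the colon (P : x) is
   a prime ideal, and each of the three hypotheses makes it maximal: in (1) by
   dimension zero, in (2) because it contains a nonzero annihilator of x, and in
   (3) by stabilization of the chain P + R r^n x.  When all proper colons are
   maximal, M/P is semisimple, and a submodule containing P and maximal among
   those avoiding a given x outside P is a maximal submodule. *)
Require Import Defs.
From mathcomp Require Import ring.

Set Implicit Arguments.
Unset Strict Implicit.
Unset Printing Implicit Defensive.

Import GRing.Theory.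
Local Open Scope classical_set_scope.
Local Open Scope ring_scope.

Section Submodules.
Variables (R : comNzRingType) (M : lmodType R).
Implicit Types (N P : set M) (x y : M) (r s : R).

Lemma submoduleP N :
  submodule N <->
  N 0 /\ forall a u v, N u -> N v -> N (a *: u + v).
Proof.
rewrite /submodule /GRing.submod_closed /GRing.linear_closed; split.
  move=> [N0 Nlin]; split; first by have := N0; rewrite inE.
  by move=> a u v Nu Nv; have := Nlin a u v; rewrite !inE; apply.
move=> [N0 Nlin]; split; first by rewrite inE.
by move=> a u v; rewrite !inE; exact: Nlin.
Qed.

Lemma submodule0 N : submodule N -> N 0.
Proof. by case/submoduleP. Qed.

Lemma submoduleD N x y : submodule N -> N x -> N y -> N (x + y).
Proof. by case/submoduleP=> _ + Nx Ny => /(_ 1 x y Nx Ny); rewrite scale1r. Qed.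

Lemma submoduleZ N r x : submodule N -> N x -> N (r *: x).
Proof.
by case/submoduleP=> N0 + Nx => /(_ r x 0 Nx N0); rewrite addr0.
Qed.

Lemma submoduleB N x y : submodule N -> N x -> N y -> N (x - y).
Proof.
move=> subN Nx Ny; rewrite -scaleN1r.
by apply: submoduleD => //; exact: submoduleZ.
Qed.

(** The submodule [N + R x], encoded by a difference so that only the coefficient of [x] is
    quantified. *)
Definition add_cyclic N x : set M := [set y | exists s, N (y - s *: x)].

Lemma submodule_add_cyclic N x : submodule N -> submodule (add_cyclic N x).
Proof.
move=> subN; apply/submoduleP; split.
  by exists 0; rewrite scale0r subr0; exact: submodule0.
move=> a u v [s Ns] [t Nt]; exists (a * s + t).
have -> : a *: u + v - (a * s + t) *: x = a *: (u - s *: x) + (v - t *: x).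
  by rewrite scalerBr scalerA scalerDl opprD addrACA.
by apply: submoduleD => //; exact: submoduleZ.
Qed.

Lemma sub_add_cyclic N x : N `<=` add_cyclic N x.
Proof. by move=> y Ny; exists 0; rewrite scale0r subr0. Qed.

Lemma mem_add_cyclic N x : submodule N -> add_cyclic N x x.
Proof. by move=> subN; exists 1; rewrite scale1r subrr; exact: submodule0. Qed.

(** By Zorn's lemma. It is used twice: for [x] outside a classical prime submodule, and for [1]
    outside an ideal of [R]. *)
Lemma exists_maximal_avoiding P x : submodule P -> ~ P x ->
  exists N, [/\ submodule N, P `<=` N, ~ N x &
    forall K, submodule K -> N `<=` K -> ~ K x -> K = N].
Proof.
move=> subP Px.
(* Joining P makes the empty chain harmless. *)
pose Q := [set X : set M | submodule (P `|` X) /\ ~ (P `|` X) x].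
have [F FQ Ftot|A [[subA Ax] Amax]] := @Zorn_bigcup M Q.
  split; last by case=> // -[X FX Xx]; case: (FQ X FX) => _; apply; right.
  apply/submoduleP; split; first by left; exact: submodule0.
  (* Closure reduces to one member of the chain; totality brings [u] and [v] into a common one. *)
  have inF X a u v : F X -> (P `|` X) u -> (P `|` X) v ->
      (P `|` \bigcup_(X in F) X) (a *: u + v).
    move=> FX Xu Xv; have [/submoduleP[_ /(_ a u v Xu Xv)] + _] := FQ X FX.
    by case=> [|Xuv]; [left | right; exists X].
  move=> a u v [Pu|[X FX Xu]] [Pv|[Y FY Yv]].
  - by left; apply: submoduleD => //; exact: submoduleZ.
  - by apply: (inF Y) => //; [left | right].
  - by apply: (inF X) => //; [right | left].
  - case: (Ftot X Y FX FY) => sub.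
    + by apply: (inF Y) => //; right => //; exact: sub.
    + by apply: (inF X) => //; right => //; exact: sub.
exists (P `|` A); split=> //.
move=> K subK PAK Kx; apply: contrapT => KneqPA.
have PK : P `|` K = K by apply: setUidr => y Py; apply: PAK; left.
apply: (Amax K); last by split; rewrite PK.
split; first by move=> y Ay; apply: PAK; right.
by move=> KA; apply: KneqPA; apply/seteqP; split=> // y Ky; right; exact: KA.
Qed.

(* The hypothesis on P says that every colon (P : y) is maximal or R itself. *)
Lemma bigcap_maximal_submodule P : submodule P ->
  (forall r y, P (r *: y) \/ exists s, P (y - s *: (r *: y))) ->
  exists F : set (set M),
    (forall N, F N -> maximal_submodule N) /\ P = \bigcap_(N in F) N.
Proof.
move=> subP Pcolon; exists [set N | maximal_submodule N /\ P `<=` N].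
split; first by move=> N [].
apply/seteqP; split; first by move=> y Py N [_]; apply.
move=> x Fx; apply: contrapT => Px.
have [N [subN PN Nx Nmax]] := exists_maximal_avoiding subP Px.
apply: (Nx); apply: (Fx N); split=> //; split.
  by split=> //; split=> // /(_ x I).
(* By the choice of [N], a proper [K] above [N] equals [N] unless it contains [x]; in that case
   every [y] is shown to lie in [K]. *)
move=> K [subK [_ Kprop]] NK; apply: (Nmax) => // Kx; apply: Kprop => y _.
have [Ny|Ny] := pselect (N y); first exact: NK.
(* As [y] is not in [N], the submodule [N + R y] is strictly larger than [N] and so contains [x]. *)
have [t Nxty] : add_cyclic N y x.
  apply: contrapT => Nyx; apply: Ny.
  by rewrite -(Nmax _ (submodule_add_cyclic y subN) (@sub_add_cyclic N y) Nyx);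
    exact: mem_add_cyclic.
have Kty : K (t *: y).
  by rewrite -[t *: y](subKr x); apply: submoduleB => //; exact: NK.
(* If [t *: y] is in [P], then [x] falls into [N], a contradiction; otherwise [y] is congruent
   modulo [P] to a multiple of [t *: y], which is in [K]. *)
have [Pty|[s Psty]] := Pcolon t y.
  case: Nx; rewrite -(subrK (t *: y) x).
  by apply: submoduleD => //; exact: PN.
rewrite -(subrK (s *: (t *: y)) y); apply: submoduleD => //; first exact/NK/PN.
exact: submoduleZ.
Qed.

End Submodules.

Section PrimeIdeals.
Variable R : comNzRingType.
Implicit Types (p q : set R) (r s : R).

(** Ideals are treated as submodules of the regular module [R^o], so that the results on submodules
    apply to them. *)
Lemma prime_idealP p :
  prime_ideal p <->
  [/\ submodule (p : set R^o), ~ p 1 & forall u v, p (u * v) -> p u \/ p v].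
Proof.
rewrite /prime_ideal /idealr_closed /prime_idealr_closed; split.
  move=> [[p0 p1 plin] pM]; split.
  - apply/submoduleP; split; first by have := p0; rewrite inE.
    by move=> a u v pu pv; have := plin a u v; rewrite !inE; apply.
  - by move=> p1'; move/negP: p1; apply; rewrite inE.
  - move=> u v puv; have := pM u v; rewrite !inE => /(_ puv)/orP.
    by case=> /asboolP; [left|right].
move=> [/submoduleP[p0 plin] p1 pM]; split; first split.
- by rewrite inE.
- by apply/negP; rewrite inE.
- by move=> a u v; rewrite !inE; exact: plin.
- by move=> u v; rewrite !inE => /pM[] ?; apply/orP; [left|right]; rewrite inE.
Qed.

(** An ideal [q] maximal among those avoiding [1] is prime: if [u] is not in [q], then [1 - s * u]
    is in [q] for some [s], and multiplying by [v] puts [v] in [q] whenever [u * v] is. *)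
Lemma exists_prime_ideal (I : set R) : submodule (I : set R^o) -> ~ I 1 ->
  exists2 q, prime_ideal q & I `<=` q.
Proof.
move=> subI I1.
have [q [subq Iq q1 qmax]] := exists_maximal_avoiding subI I1.
exists q => //; apply/prime_idealP; split=> // u v quv.
have [qu|qu] := pselect (q u); first by left.
right; have [s qsu] : add_cyclic (q : set R^o) u 1.
  apply: contrapT => q1'; apply: qu.
  by rewrite -(qmax _ (submodule_add_cyclic (u : R^o) subq)
                   (@sub_add_cyclic _ _ q u) q1'); exact: mem_add_cyclic.
have -> : v = v * (1 - s * u) + s * (u * v) by ring.
apply: (@submoduleD _ R^o) => //; exact: (@submoduleZ _ R^o).
Qed.

(** Otherwise [p + R r] is proper, and a prime containing it lies strictly above [p]. *)
Lemma invertible_modulo_maximal_prime p r :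
  prime_ideal p -> (forall q, prime_ideal q -> ~ p `<` q) -> ~ p r ->
  exists s, p (1 - s * r).
Proof.
move=> /prime_idealP[subp p1 pM] pmax pr; apply: contrapT => ns.
have [|q primeq sq] :=
  exists_prime_ideal (submodule_add_cyclic (r : R^o) subp); first exact: ns.
apply: (pmax q primeq); split.
  by move=> y py; apply: sq; exact: (@sub_add_cyclic _ R^o).
by move=> qp; apply: pr; apply: qp; apply: sq; exact: (@mem_add_cyclic _ R^o).
Qed.

End PrimeIdeals.

Section ClassicalPrime.
Variables (R : comNzRingType) (M : lmodType R).
Implicit Types (P : set M) (x y : M) (r s : R).

Lemma prime_ideal_colon P x : classical_prime P -> ~ P x ->
  prime_ideal [set r | P (r *: x)].
Proof.
move=> [[subP _] Pprime] Px; apply/prime_idealP; split=> /=.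
- apply/submoduleP; split=> /=; first by rewrite scale0r; exact: submodule0.
  move=> a u v Pu Pv; rewrite scalerDl -scalerA.
  by apply: submoduleD => //; exact: submoduleZ.
- by rewrite scale1r.
- by move=> u v /Pprime.
Qed.

Lemma cl_Hilbert_maximal_colon :
  (forall P x, classical_prime P -> ~ P x ->
     forall q, prime_ideal q -> ~ [set r | P (r *: x)] `<` q) ->
  cl_Hilbert M.
Proof.
move=> colon_max P Pprime; have [[subP _] _] := Pprime.
apply: bigcap_maximal_submodule => // r y.
have [Pry|Pry] := pselect (P (r *: y)); first by left.
right; have Py : ~ P y by move=> Py; apply: Pry; exact: submoduleZ.
have [s] := invertible_modulo_maximal_prime
  (prime_ideal_colon Pprime Py) (colon_max P y Pprime Py) Pry.
by rewrite /= scalerBl scale1r -scalerA; exists s.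
Qed.

Lemma cl_Hilbert_dim0 : has_krull_dim R 0 -> cl_Hilbert M.
Proof.
move=> [_ dimR]; apply: cl_Hilbert_maximal_colon => P x Pprime Px q primeq Pxq.
(* The default value [q] of [nth] serves as the top term of the chain. *)
have /dimR : prime_chain 1 (nth q [:: [set r | P (r *: x)]]).
  split; last by case.
  by case=> [|[|//]] _ //=; exact: prime_ideal_colon.
by [].
Qed.

Lemma cl_Hilbert_dim1_torsion :
  GRing.integral_domain_axiom R -> has_krull_dim R 1 -> torsion_module M ->
  cl_Hilbert M.
Proof.
move=> domR [_ dimR] torM.
apply: cl_Hilbert_maximal_colon => P x Pprime Px q primeq Pxq.
have subP : submodule P by case: Pprime => [[]].
have prime0 : prime_ideal [set (0 : R)].
  apply/prime_idealP; split=> /=.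
  - by apply/submoduleP; split=> //= a u v -> ->; rewrite scaler0 addr0.
  - by apply/eqP; exact: oner_neq0.
  - by move=> u v /domR/orP[]/eqP; [left|right].
have colon0 : [set 0] `<` [set r | P (r *: x)].
  split=> [_ ->|colon0] /=; first by rewrite scale0r; exact: submodule0.
  (* A nonzero annihilator of [x] makes the inclusion strict. *)
  have [r /eqP r0 rx] := torM x; apply/r0/colon0 => /=.
  by rewrite rx; exact: submodule0.
have /dimR : prime_chain 2 (nth q [:: [set 0]; [set r | P (r *: x)]]).
  split; last by case=> [|[]].
  by case=> [|[|[|//]]] _ //=; exact: prime_ideal_colon.
by [].
Qed.

(** Stabilization of [P + R r^i y] at [k] gives [r^k (1 - s r) y] in [P], and classical primality
    splits this product. *)
Lemma cl_Hilbert_artinian : artinian_module M -> cl_Hilbert M.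
Proof.
move=> artM P Pprime; have [[subP _] Pmul] := Pprime.
apply: bigcap_maximal_submodule => // r y.
have [k Nk] : exists k, forall i, (k <= i)%N ->
    add_cyclic P (r ^+ i *: y) = add_cyclic P (r ^+ k *: y).
  apply: (artM (fun i => add_cyclic P (r ^+ i *: y))) => i.
    exact: submodule_add_cyclic.
  move=> z [s Pz]; exists (s * r).
  by move: Pz; rewrite !scalerA exprS mulrA.
have [s Ps] : add_cyclic P (r ^+ k.+1 *: y) (r ^+ k *: y).
  by rewrite Nk //; exact: mem_add_cyclic.
have : P ((r ^+ k * (1 - s * r)) *: y).
  move: Ps; rewrite scalerA -scalerBl.
  have -> // : r ^+ k - s * r ^+ k.+1 = r ^+ k * (1 - s * r).
  by rewrite exprS; ring.
case/Pmul => [Prk|]; last first.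
  by rewrite scalerBl scale1r -scalerA; right; exists s.
(* Classical primality strips factors [r] off [r ^+ k *: y] one at a time; at [k = 0], [y] itself is
   in [P]. *)
left; elim: k Prk {Nk Ps} => [|k IHk].
  by rewrite expr0 scale1r; exact: submoduleZ.
by rewrite exprS => /Pmul[].
Qed.

End ClassicalPrime.

Theorem theorem2p17 (R : comNzRingType) (M : lmodType R) :
  [/\ has_krull_dim R 0 -> cl_Hilbert M,
      GRing.integral_domain_axiom R -> has_krull_dim R 1 ->
        torsion_module M -> cl_Hilbert M
    & artinian_module M -> cl_Hilbert M].
Proof.
split.
- exact: cl_Hilbert_dim0.
- exact: cl_Hilbert_dim1_torsion.
- exact: cl_Hilbert_artinian.
Qed.
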